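(* For all integers $k,n\ge 1$, \begin{align*} &(-1)^{k}\zeta^*(k+1,\underbrace{1,\dots,1}_{n})-(-1)^{n}\zeta^*(n+1,\underbrace{1,\dots,1}_{k})\\ &=k\,\zeta(k+2,\underbrace{1,\dots,1}_{n-1})-n\,\zeta(n+2,\underbrace{1,\dots,1}_{k-1})\\ &\quad+(-1)^{k}\sum_{r=0}^{k-2}(-1)^r\zeta(k-r)\,\zeta(n+1,\underbrace{1,\dots,1}_{r}) -(-1)^{n}\sum_{r=0}^{n-2}(-1)^r\zeta(n-r)\,\zeta(k+1,\underbrace{1,\dots,1}_{r}), \end{align*} where an empty sum (e.g. $\sum_{r=0}^{-1}$) equals $0$.
   Context: For positive integers $k_1,\dots,k_n$ with $k_1\ge 2$, the multiple zeta value is $\zeta(k_1,\dots,k_n)=\sum_{m_1>m_2>\dots>m_n\ge 1}\frac{1}{m_1^{k_1}\cdots m_n^{k_n}}$ and the multiple zeta-star value is $\zeta^*(k_1,\dots,k_n)=\sum_{m_1\ge m_2\ge\dots\ge m_n\ge 1}\frac{1}{m_1^{k_1}\cdots m_n^{k_n}}$. For $n=1$ these are the Riemann zeta value $\zeta(k_1)$. The notation $\underbrace{1,\dots,1}_{r}$ denotes $r$ consecutive entries equal to $1$ (none if $r=0$). *)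

(* Defs.v *)
From Stdlib Require Import Reals List.
From Coquelicot Require Import Coquelicot.
Open Scope R_scope.

Fixpoint mzv_trunc (ks : list nat) (N : nat) : R :=
  match ks with
  | nil => 1
  | k :: ks' =>
      fold_right Rplus 0
        (map (fun m => / (INR m) ^ k * mzv_trunc ks' (m - 1)%nat) (seq 1 N))
  end.

Fixpoint mzsv_trunc (ks : list nat) (N : nat) : R :=
  match ks with
  | nil => 1
  | k :: ks' =>
      fold_right Rplus 0
        (map (fun m => / (INR m) ^ k * mzsv_trunc ks' m) (seq 1 N))
  end.

Definition mzv (ks : list nat) : R := real (Lim_seq (mzv_trunc ks)).
Definition mzsv (ks : list nat) : R := real (Lim_seq (mzsv_trunc ks)).

Definition sum_lt (n : nat) (f : nat -> R) : R :=
  fold_right Rplus 0 (map f (seq 0 n)).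

(* Main.v *)
(** Put [e_r(m)] and [h_r(m)] for the elementary and complete symmetric
    functions of [1, 1/2, ..., 1/m], [H = e_1], and
    [Q(k,n) = sum_a e_{n-1}(a-1) H_a / a^(k+1)].

    Summation by parts gives [sum_a e_{n-1}(a-1) / (a (a+b)) = h_n(b) / b], hence
    [zeta*(k+1,1^n) = sum_{a,b} e_{n-1}(a-1) / (a b^k (a+b))].  Summing over [b]
    first, by partial fractions, expresses it as
    [sum_i (-1)^i zeta(k-i) zeta(i+2,1^(n-1)) + (-1)^(k-1) Q(k,n)].

    With the weight [c(a,b) = a! b! / (a+b)!] the same summation by parts gives
    [sum_b e_{k-1}(b-1) / b * c(a,b) = a^(-k)] and
    [sum_b e_{k-1}(b-1) / b * c(a,b) H_{a+b} = H_a a^(-k) + k a^(-k-1)].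
    Multiplying by [e_{n-1}(a-1) / a] and summing over [a] yields double series
    symmetric in [(a,k)] and [(b,n)].  The first is the duality
    [zeta(k+1,1^(n-1)) = zeta(n+1,1^(k-1))]; the second says that
    [Q(k,n) + k zeta(k+2,1^(n-1))] is symmetric in [k] and [n].

    Series are indexed from 0, so the index [i] stands for the summation
    variable [a = i + 1]. *)

Require Import Defs.
From Stdlib Require Import Reals List Factorial Lia Lra.
From Coquelicot Require Import Coquelicot.
Open Scope R_scope.

(** * Finite sums, series, and interchange of nonnegative double series *)

Lemma sum_lt_S (N : nat) (f : nat -> R) : sum_lt (S N) f = sum_lt N f + f N.
Proof.
  unfold sum_lt. rewrite seq_S, map_app, fold_right_app. simpl.
  generalize (map f (seq 0 N)) as l. intro l.
  induction l as [|y l IH]; simpl; [|rewrite IH]; ring.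
Qed.

Lemma sum_lt_ext (N : nat) (f g : nat -> R) :
  (forall i, (i < N)%nat -> f i = g i) -> sum_lt N f = sum_lt N g.
Proof.
  induction N as [|N IH]; intro E; [reflexivity|].
  rewrite !sum_lt_S, IH, E; auto.
Qed.

Lemma sum_lt_le (N : nat) (f g : nat -> R) :
  (forall i, (i < N)%nat -> f i <= g i) -> sum_lt N f <= sum_lt N g.
Proof.
  induction N as [|N IH]; intro E; [apply Rle_refl|].
  rewrite !sum_lt_S. apply Rplus_le_compat; auto.
Qed.

Lemma sum_lt_scal (N : nat) (c : R) (f : nat -> R) :
  sum_lt N (fun i => c * f i) = c * sum_lt N f.
Proof.
  induction N as [|N IH]; [unfold sum_lt; simpl; ring|].
  rewrite !sum_lt_S, IH. ring.
Qed.

Lemma is_series_sum_lt (a : nat -> R) (l : R) :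
  is_series a l <-> is_lim_seq (fun N => sum_lt N a) l.
Proof.
  rewrite is_lim_seq_incr_1.
  assert (E : forall N, sum_n a N = sum_lt (S N) a).
  { induction N as [|N IH].
    - rewrite sum_O. unfold sum_lt; simpl; ring.
    - rewrite sum_Sn, IH, (sum_lt_S (S N)). reflexivity. }
  split; intro L.
  - apply is_lim_seq_ext with (1 := E). exact L.
  - apply is_lim_seq_ext with (1 := fun N => eq_sym (E N)) in L. exact L.
Qed.

Lemma is_series_add (a b : nat -> R) (la lb : R) :
  is_series a la -> is_series b lb -> is_series (fun i => a i + b i) (la + lb).
Proof. exact (is_series_plus a b la lb). Qed.

Lemma is_series_mul (c : R) (a : nat -> R) (l : R) :
  is_series a l -> is_series (fun i => c * a i) (c * l).
Proof. exact (is_series_scal_l c a l). Qed.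

Lemma is_series_ext_R (a b : nat -> R) (la lb : R) :
  (forall i, a i = b i) -> la = lb -> is_series a la -> is_series b lb.
Proof. intros E <-. now apply is_series_ext. Qed.

Lemma is_series_sum_lt_fun (M : nat) (u : nat -> nat -> R) (l : nat -> R) :
  (forall i, (i < M)%nat -> is_series (u i) (l i)) ->
  is_series (fun j => sum_lt M (fun i => u i j)) (sum_lt M l).
Proof.
  induction M as [|M IH]; intro L.
  - apply is_series_sum_lt. apply is_lim_seq_ext with (fun _ => 0).
    + induction n as [|n IH]; [reflexivity|].
      rewrite sum_lt_S, <- IH. unfold sum_lt; simpl; ring.
    + apply is_lim_seq_const.
  - apply is_series_ext_R with (3 := is_series_add _ _ _ _
      (IH (fun i Hi => L i (Nat.lt_lt_succ_r _ _ Hi))) (L M (Nat.lt_succ_diag_r M))).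
    + intro j. now rewrite sum_lt_S.
    + now rewrite sum_lt_S.
Qed.

Lemma ex_series_dom (a b : nat -> R) :
  (forall i, 0 <= a i <= b i) -> ex_series b -> ex_series a.
Proof.
  intros D. apply (@ex_series_le R_AbsRing R_CompleteNormedModule).
  intro i. change (Rabs (a i) <= b i). rewrite Rabs_pos_eq; apply D.
Qed.

Lemma sum_lt_le_series (a : nat -> R) (l : R) (N : nat) :
  (forall i, 0 <= a i) -> is_series a l -> sum_lt N a <= l.
Proof.
  intros P L%is_series_sum_lt.
  apply (is_lim_seq_incr_compare (fun N => sum_lt N a) l L).
  intro i. rewrite sum_lt_S. specialize (P i). lra.
Qed.

(** A finite block of rows sums, column by column, to partial column sums, each at most [c j]. The
    block totals therefore stay below [sc], and the number of rows is then sent to infinity. *)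
Lemma double_series_le (u : nat -> nat -> R) (r c : nat -> R) (sr sc : R) :
  (forall i j, 0 <= u i j) ->
  (forall i, is_series (u i) (r i)) ->
  (forall j, is_series (fun i => u i j) (c j)) ->
  is_series r sr -> is_series c sc -> sr <= sc.
Proof.
  intros P Lr Lc Sr Sc.
  apply is_series_sum_lt in Sr.
  apply (is_lim_seq_le (fun N => sum_lt N r) (fun _ => sc) sr sc);
    [|assumption|apply is_lim_seq_const].
  intro N.
  assert (LN := is_series_sum_lt_fun N u r (fun i _ => Lr i)).
  apply is_series_sum_lt in LN. apply is_series_sum_lt in Sc.
  apply (is_lim_seq_le _ _ _ _ (fun M => sum_lt_le M _ c
    (fun j _ => sum_lt_le_series _ _ N (fun i => P i j) (Lc j))) LN Sc).
Qed.

Lemma double_series_eq (u : nat -> nat -> R) (r c : nat -> R) (sr sc : R) :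
  (forall i j, 0 <= u i j) ->
  (forall i, is_series (u i) (r i)) ->
  (forall j, is_series (fun i => u i j) (c j)) ->
  is_series r sr -> is_series c sc -> sr = sc.
Proof.
  intros P Lr Lc Sr Sc. apply Rle_antisym.
  - exact (double_series_le u r c sr sc P Lr Lc Sr Sc).
  - exact (double_series_le (fun j i => u i j) c r sc sr (fun j i => P i j) Lc Lr Sc Sr).
Qed.

(** * Symmetric functions of the reciprocals: recursions and bounds *)

Definition esym (r m : nat) : R := mzv_trunc (repeat 1%nat r) m.
Definition hsym (r m : nat) : R := mzsv_trunc (repeat 1%nat r) m.
Definition harm (m : nat) : R := esym 1 m.

Lemma mzv_trunc_cons (k : nat) (ks : list nat) (N : nat) :
  mzv_trunc (k :: ks) N = sum_lt N (fun i => mzv_trunc ks i / INR (S i) ^ k).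
Proof.
  unfold sum_lt. cbn [mzv_trunc].
  rewrite <- seq_shift, map_map. f_equal. apply map_ext. intro i.
  rewrite Nat.sub_succ, Nat.sub_0_r. unfold Rdiv. ring.
Qed.

Lemma mzsv_trunc_cons (k : nat) (ks : list nat) (N : nat) :
  mzsv_trunc (k :: ks) N = sum_lt N (fun i => mzsv_trunc ks (S i) / INR (S i) ^ k).
Proof.
  unfold sum_lt. cbn [mzsv_trunc].
  rewrite <- seq_shift, map_map. f_equal. apply map_ext. intro i.
  unfold Rdiv. ring.
Qed.

Lemma INR_S_pos (i : nat) : 0 < INR (S i).
Proof. apply lt_0_INR. lia. Qed.

Lemma INR_S_ge1 (i : nat) : 1 <= INR (S i).
Proof. apply (le_INR 1). lia. Qed.

Lemma esym_0 (m : nat) : esym 0 m = 1.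
Proof. reflexivity. Qed.

Lemma esym_S_0 (r : nat) : esym (S r) 0 = 0.
Proof. reflexivity. Qed.

Lemma esym_S_S (r m : nat) : esym (S r) (S m) = esym (S r) m + esym r m / INR (S m).
Proof.
  unfold esym. cbn [repeat]. rewrite !mzv_trunc_cons, sum_lt_S. now rewrite pow_1.
Qed.

Lemma hsym_S_S (r m : nat) :
  hsym (S r) (S m) = hsym (S r) m + hsym r (S m) / INR (S m).
Proof.
  unfold hsym. cbn [repeat]. rewrite !mzsv_trunc_cons, sum_lt_S. now rewrite pow_1.
Qed.

Lemma harm_S (m : nat) : harm (S m) = harm m + / INR (S m).
Proof. unfold harm. rewrite esym_S_S, esym_0. unfold Rdiv. ring. Qed.

Lemma esym_ge0 (r m : nat) : 0 <= esym r m.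
Proof.
  revert m; induction r as [|r IHr]; intro m; [rewrite esym_0; lra|].
  induction m as [|m IHm]; [rewrite esym_S_0; lra|].
  rewrite esym_S_S. apply Rplus_le_le_0_compat; [assumption|].
  apply Rdiv_le_0_compat; [apply IHr|apply INR_S_pos].
Qed.

Lemma hsym_ge0 (r m : nat) : 0 <= hsym r m.
Proof.
  revert m; induction r as [|r IHr]; intro m; [change (0 <= 1); lra|].
  induction m as [|m IHm]; [change (0 <= 0); lra|].
  rewrite hsym_S_S. apply Rplus_le_le_0_compat; [assumption|].
  apply Rdiv_le_0_compat; [apply IHr|apply INR_S_pos].
Qed.

Lemma harm_ge0 (m : nat) : 0 <= harm m.
Proof. apply esym_ge0. Qed.

Lemma harm_mono (m p : nat) : (m <= p)%nat -> harm m <= harm p.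
Proof.
  induction 1 as [|p _ IH]; [lra|].
  rewrite harm_S. assert (0 < / INR (S p)) by apply Rinv_0_lt_compat, INR_S_pos. lra.
Qed.

Lemma hsym_le_harm_pow (r m : nat) : hsym r m <= harm m ^ r.
Proof.
  revert m; induction r as [|r IHr]; intro m; [change (1 <= 1); lra|].
  (* The power stays frozen at the outer [m], so the induction on the upper end [p] only has to
     accumulate the factors [/ INR (S p)]. *)
  enough (G : forall p, (p <= m)%nat -> hsym (S r) p <= harm m ^ r * harm p).
  { rewrite <- tech_pow_Rmult, Rmult_comm. now apply G. }
  induction p as [|p IHp]; intro Hp.
  - change (0 <= harm m ^ r * 0). lra.
  - rewrite hsym_S_S, harm_S, Rmult_plus_distr_l.
    apply Rplus_le_compat; [apply IHp; lia|].
    apply Rmult_le_compat_r; [left; apply Rinv_0_lt_compat, INR_S_pos|].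
    apply Rle_trans with (1 := IHr _).
    apply pow_incr. split; [apply harm_ge0|now apply harm_mono].
Qed.

Lemma esym_le_hsym (r m : nat) : esym r m <= hsym r m.
Proof.
  revert m; induction r as [|r IHr]; intro m; [apply Rle_refl|].
  induction m as [|m IHm]; [apply Rle_refl|].
  rewrite esym_S_S, hsym_S_S. apply Rplus_le_compat; [assumption|].
  apply Rmult_le_compat_r; [left; apply Rinv_0_lt_compat, INR_S_pos|].
  apply Rle_trans with (1 := IHr _).
  (* What remains is monotonicity in the upper end: the recursion adds a nonnegative term to
     [hsym r m]. *)
  destruct r as [|r]; [apply Rle_refl|]. rewrite hsym_S_S.
  assert (0 <= hsym r (S m) / INR (S m))
    by (apply Rdiv_le_0_compat; [apply hsym_ge0|apply INR_S_pos]).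
  lra.
Qed.

Lemma esym_le_harm_pow (r m : nat) : esym r m <= harm m ^ r.
Proof. exact (Rle_trans _ _ _ (esym_le_hsym r m) (hsym_le_harm_pow r m)). Qed.

(** * Growth of harmonic numbers and convergence *)

(** This is [H_m <= 1 + log m] in exponential form, where the induction multiplies one factor at a
    time. *)
Lemma exp_harm_le (m : nat) : exp (harm (S m)) <= exp 1 * INR (S m).
Proof.
  induction m as [|m IH].
  - unfold harm. rewrite esym_S_S, esym_0, esym_S_0. simpl.
    replace (0 + 1 / 1) with 1 by field. lra.
  - rewrite harm_S, exp_plus.
    assert (P := INR_S_pos m). assert (E := S_INR (S m)).
    (* Inverting [1 - x <= exp (- x)] at [x = 1 / (m + 2)]. *)
    assert (B : exp (/ INR (S (S m))) <= INR (S (S m)) / INR (S m)).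
    { assert (G := exp_ineq1_le (- / INR (S (S m)))).
      replace (1 + - / INR (S (S m))) with (INR (S m) / INR (S (S m))) in G
        by (rewrite E; field; lra).
      rewrite exp_Ropp in G. apply Rinv_le_contravar in G;
        [|apply Rdiv_lt_0_compat; lra].
      rewrite Rinv_inv in G. apply Rle_trans with (1 := G).
      right. field. lra. }
    apply Rle_trans with (exp 1 * INR (S m) * (INR (S (S m)) / INR (S m))).
    + apply Rmult_le_compat; auto; left; apply exp_pos.
    + right. field. lra.
Qed.

Lemma exp_INR_mul (n : nat) (x : R) : exp (INR n * x) = exp x ^ n.
Proof.
  induction n as [|n IH]; [simpl; rewrite Rmult_0_l; apply exp_0|].
  rewrite S_INR, Rmult_plus_distr_r, Rmult_1_l, exp_plus, IH, Rmult_comm. reflexivity.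
Qed.

Lemma harm_pow_le_sqrt (p : nat) :
  exists C, 0 <= C /\ forall m, harm (S m) ^ p <= C * sqrt (INR (S m)).
Proof.
  (* [(h / N)^(2p) <= exp (h / N)^N = exp h = O(m)] for [h = H_m] and [N = 2p + 1]. *)
  set (N := INR (S (2 * p))). assert (HN : 0 < N) by apply INR_S_pos.
  exists (N ^ p * sqrt (exp 1)). split.
  { apply Rmult_le_pos; [apply pow_le; lra|apply sqrt_pos]. }
  intro m. rewrite Rmult_assoc, <- sqrt_mult; [|left; apply exp_pos|left; apply INR_S_pos].
  set (h := harm (S m)). assert (Hh : 0 <= h / N)
    by (apply Rdiv_le_0_compat; [apply harm_ge0|assumption]).
  replace (h ^ p) with (N ^ p * (h / N) ^ p)
    by (unfold Rdiv; rewrite <- Rpow_mult_distr; f_equal; field; lra).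
  apply Rmult_le_compat_l; [apply pow_le; lra|].
  rewrite <- (sqrt_pow2 ((h / N) ^ p)) by now apply pow_le.
  apply sqrt_le_1_alt. rewrite <- pow_mult, Nat.mul_comm.
  apply Rle_trans with (2 := exp_harm_le m). fold h.
  assert (E : exp h = exp (h / N) ^ (S (2 * p))).
  { rewrite <- exp_INR_mul. fold N. f_equal. field. lra. }
  rewrite E. assert (G := exp_ineq1_le (h / N)).
  apply Rle_trans with (exp (h / N) ^ (2 * p)).
  - apply pow_incr. lra.
  - apply Rle_pow; [lra|lia].
Qed.

Lemma ex_series_sqrt : ex_series (fun i => sqrt (INR (S i)) / INR (S i) ^ 2).
Proof.
  (* [m^(-3/2) <= 4 (m^(-1/2) - (m+1)^(-1/2))] *)
  assert (B : forall N, sum_lt N (fun i => sqrt (INR (S i)) / INR (S i) ^ 2)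
              <= 4 - 4 / sqrt (INR (S N))).
  { induction N as [|N IH].
    - unfold sum_lt; simpl. rewrite sqrt_1. lra.
    - rewrite sum_lt_S.
      assert (Q1 := sqrt_sqrt _ (Rlt_le _ _ (INR_S_pos N))).
      assert (Q2 := sqrt_sqrt _ (Rlt_le _ _ (INR_S_pos (S N)))).
      assert (P1 := sqrt_lt_R0 _ (INR_S_pos N)).
      assert (P2 := sqrt_lt_R0 _ (INR_S_pos (S N))).
      assert (G := INR_S_ge1 N).
      assert (E := S_INR (S N)).
      set (s := sqrt (INR (S N))) in *. set (t := sqrt (INR (S (S N)))) in *.
      rewrite <- Q1 in *.
      assert (T : t <= 2 * s) by nra.
      enough (s / (s * s) ^ 2 <= 4 / s - 4 / t) by lra.
      replace (4 / s - 4 / t) with (4 * ((t * t - s * s) / (s * t * (s + t))))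
        by (field; lra).
      replace (t * t - s * s) with 1 by lra.
      (* Here [t * s <= 2 s^2] by [T], and [t^2 = s^2 + 1 <= 2 s^2] because [s^2 >= 1]; this is
         where the constant 4 comes from. *)
      assert (K : t * (s + t) <= 4 * (s * s)) by nra.
      apply Rmult_le_reg_r with (s * s * s * (t * (s + t))); [repeat apply Rmult_lt_0_compat; lra|].
      replace (s / (s * s) ^ 2 * (s * s * s * (t * (s + t)))) with (t * (s + t)) by (field; lra).
      replace (4 * (1 / (s * t * (s + t))) * (s * s * s * (t * (s + t)))) with (4 * (s * s))
        by (field; lra).
      exact K. }
  destruct (ex_finite_lim_seq_incr
    (fun N => sum_lt N (fun i => sqrt (INR (S i)) / INR (S i) ^ 2)) 4) as [l L].
  - intro N. rewrite sum_lt_S.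
    assert (0 <= sqrt (INR (S N)) / INR (S N) ^ 2)
      by (apply Rdiv_le_0_compat; [apply sqrt_pos|apply pow_lt, INR_S_pos]).
    lra.
  - intro N. apply Rle_trans with (1 := B N).
    assert (0 < 4 / sqrt (INR (S N)))
      by (apply Rdiv_lt_0_compat; [lra|apply sqrt_lt_R0, INR_S_pos]).
    lra.
  - exists l. now apply is_series_sum_lt.
Qed.

(** Every power of [H_m] is [O(sqrt m)], so an exponent of at least 2 leaves a multiple of the
    convergent series of [m^(-3/2)]. *)
Lemma ex_series_harm_dom (p s : nat) (a : nat -> R) :
  (2 <= s)%nat -> (forall i, 0 <= a i <= harm (S i) ^ p) ->
  ex_series (fun i => a i / INR (S i) ^ s).
Proof.
  intros Hs D. destruct (harm_pow_le_sqrt p) as (C & C0 & HC).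
  apply ex_series_dom with (fun i => C * (sqrt (INR (S i)) / INR (S i) ^ 2)).
  - intro i. destruct (D i) as [D0 D1]. specialize (HC i).
    assert (P := INR_S_pos i). split.
    + apply Rdiv_le_0_compat; [lra|now apply pow_lt].
    + unfold Rdiv. rewrite <- Rmult_assoc. apply Rmult_le_compat; try lra.
      * left. now apply Rinv_0_lt_compat, pow_lt.
      * apply Rinv_le_contravar; [now apply pow_lt|].
        apply Rle_pow; [apply INR_S_ge1|assumption].
  - apply (ex_series_scal_l (V := R_NormedModule) C), ex_series_sqrt.
Qed.

Lemma is_lim_seq_sqrt_div :
  is_lim_seq (fun j => sqrt (INR (S j)) / INR (S j)) 0.
Proof.
  apply is_lim_seq_ext with (fun j => sqrt (/ INR (S j))).
  - intro j. assert (P := INR_S_pos j). rewrite sqrt_inv.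
    rewrite <- (sqrt_sqrt (INR (S j))) at 3 by lra.
    field. assert (G := sqrt_lt_R0 _ P). lra.
  - rewrite <- sqrt_0. apply is_lim_seq_continuous.
    + apply continuity_pt_sqrt. lra.
    + apply (is_lim_seq_inv (fun j => INR (S j)) p_infty); [|discriminate].
      rewrite <- (is_lim_seq_incr_1 INR). apply is_lim_seq_INR.
Qed.

(** * Summation by parts against [esym] *)

(** Kills the boundary term at infinity in the summations by parts: the product is [O(H^(r+p) / j)],
    hence [O(j^(-1/2))]. The power [p] and the shift [q] make room for weights that contain
    [H_{a+j}]. *)
Lemma esym_mul_decay (r p q : nat) (g : nat -> R) :
  (forall j, 0 <= g j <= harm (S (q + j)) ^ p / INR (S j)) ->
  is_lim_seq (fun j => esym r j * g j) 0.
Proof.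
  intro D. destruct (harm_pow_le_sqrt (r + p)) as (C & C0 & HC).
  apply is_lim_seq_le_le with (fun _ => 0)
    (fun j => C * sqrt (INR (S q)) * (sqrt (INR (S j)) / INR (S j))).
  - intro j. destruct (D j) as [D0 D1]. assert (P := INR_S_pos j). split.
    + apply Rmult_le_pos; [apply esym_ge0|assumption].
    + assert (B : esym r j <= harm (S (q + j)) ^ r).
      { apply Rle_trans with (1 := esym_le_harm_pow r j).
        apply pow_incr. split; [apply harm_ge0|apply harm_mono; lia]. }
      apply Rle_trans with (harm (S (q + j)) ^ r * (harm (S (q + j)) ^ p / INR (S j))).
      { apply Rmult_le_compat; auto. apply esym_ge0. }
      unfold Rdiv. rewrite <- !Rmult_assoc, <- pow_add.
      apply Rmult_le_compat_r; [left; now apply Rinv_0_lt_compat|].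
      apply Rle_trans with (1 := HC (q + j)%nat).
      rewrite Rmult_assoc. apply Rmult_le_compat_l; [assumption|].
      (* The inequality [q + j + 1 <= (q + 1) (j + 1)] moves the shift into the constant. *)
      rewrite <- sqrt_mult_alt by (left; apply INR_S_pos).
      apply sqrt_le_1_alt. rewrite <- mult_INR. apply le_INR. nia.
  - apply is_lim_seq_const.
  - replace (Finite 0) with (Rbar_mult (C * sqrt (INR (S q))) 0)
      by (simpl; f_equal; ring).
    apply is_lim_seq_scal_l, is_lim_seq_sqrt_div.
Qed.

(** Plain telescoping, since [e_0 = 1]; the boundary value at 0 survives. *)
Lemma is_series_esym_abel_0 (g : nat -> R) :
  is_lim_seq (fun j => esym 0 j * g j) 0 ->
  is_series (fun j => esym 0 j * (g j - g (S j))) (g 0%nat).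
Proof.
  intro L. apply is_series_sum_lt.
  apply is_lim_seq_ext with (fun N => g 0%nat - esym 0 N * g N).
  - induction n as [|n IH]; [unfold sum_lt; simpl; rewrite esym_0; ring|].
    rewrite sum_lt_S, <- IH, !esym_0. ring.
  - replace (Finite (g 0%nat)) with (Finite (g 0%nat - 0)) by (f_equal; ring).
    apply is_lim_seq_minus'; [apply is_lim_seq_const|assumption].
Qed.

(** The increment of [esym (S r)] at [j] is [esym r j / INR (S j)], and [esym (S r) 0 = 0] removes
    the boundary term at 0. *)
Lemma is_series_esym_abel (r : nat) (g : nat -> R) (l : R) :
  is_lim_seq (fun j => esym (S r) j * g j) 0 ->
  is_series (fun j => esym r j / INR (S j) * g (S j)) l ->
  is_series (fun j => esym (S r) j * (g j - g (S j))) l.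
Proof.
  intros L K%is_series_sum_lt. apply is_series_sum_lt.
  apply is_lim_seq_ext with (fun N =>
    sum_lt N (fun j => esym r j / INR (S j) * g (S j))
    - esym (S r) N * g N).
  - induction n as [|n IH]; [unfold sum_lt; simpl; rewrite esym_S_0; ring|].
    rewrite !sum_lt_S, <- IH, esym_S_S. ring.
  - replace (Finite l) with (Finite (l - 0)) by (f_equal; ring).
    now apply is_lim_seq_minus'.
Qed.

(** Induction on [b] inside an induction on [r]: both sides vanish at [b = 0], and their increments
    in [b] agree by the case of smaller [r], taken at [b + 1]. *)
Lemma is_series_esym_harmonic (r b : nat) :
  is_series (fun j => esym r j * (/ INR (S j) - / (INR (S j) + INR b))) (hsym (S r) b).
Proof.
  revert b; induction r as [r IHr] using (well_founded_induction Wf_nat.lt_wf).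
  induction b as [|b IHb].
  { apply is_series_ext_R with (fun _ => 0) 0; [|reflexivity|].
    - intro j. simpl (INR 0). rewrite Rplus_0_r. ring.
    - apply is_series_sum_lt, is_lim_seq_ext with (fun _ => 0); [|apply is_lim_seq_const].
      induction n as [|n IH]; [reflexivity|]. rewrite sum_lt_S, <- IH. ring. }
  set (g := fun j => / (INR (S j) + INR b)).
  assert (Q := pos_INR b).
  assert (D : forall j, 0 <= g j <= harm (S (0 + j)) ^ 0 / INR (S j)).
  { intro j. assert (P := INR_S_pos j). unfold g. split.
    - left. apply Rinv_0_lt_compat. lra.
    - rewrite pow_O. unfold Rdiv. rewrite Rmult_1_l. apply Rinv_le_contravar; lra. }
  (* The increment from [b] to [b + 1]. Summation by parts turns it into
     [sum_a e_{r-1}(a-1) / (a (a+b+1))] when [r > 0], which a partial fraction reduces to the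
     induction hypothesis. *)
  enough (G : is_series (fun j => esym r j * (g j - g (S j))) (hsym r (S b) / INR (S b))).
  { rewrite hsym_S_S.
    eapply is_series_ext_R; [|reflexivity|exact (is_series_add _ _ _ _ IHb G)].
    intro j. unfold g. rewrite !(S_INR (S j)), (S_INR b).
    replace (INR (S j) + 1 + INR b) with (INR (S j) + (INR b + 1)) by ring. ring. }
  assert (L := fun r => esym_mul_decay r 0 0 g D).
  destruct r as [|r].
  - eapply is_series_ext_R; [reflexivity| |exact (is_series_esym_abel_0 g (L 0%nat))].
    unfold g. rewrite (S_INR b). change (hsym 0 (S b)) with 1. simpl (INR 1).
    field. lra.
  - apply is_series_esym_abel; [apply L|].
    eapply is_series_ext_R; [| |exact (is_series_mul (/ INR (S b)) _ _
      (IHr r (Nat.lt_succ_diag_r r) (S b)))].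
    + intro j. unfold g. rewrite !(S_INR (S j)), (S_INR b).
      assert (P := INR_S_pos j). field. lra.
    + unfold Rdiv. ring.
Qed.

(** Uses [1 / (a (a+b)) = (1/a - 1/(a+b)) / b]. *)
Lemma is_series_esym_div_add (r i : nat) :
  is_series (fun j => esym r j / INR (S j) * / (INR (S j) + INR (S i)))
    (hsym (S r) (S i) / INR (S i)).
Proof.
  eapply is_series_ext_R;
    [| |exact (is_series_mul (/ INR (S i)) _ _ (is_series_esym_harmonic r (S i)))].
  - intro j. assert (P := INR_S_pos j). assert (Q := INR_S_pos i).
    cbv beta. field. lra.
  - unfold Rdiv. ring.
Qed.

Lemma hsym_1 (m : nat) : hsym 1 m = harm m.
Proof.
  induction m as [|m IH]; [reflexivity|].
  rewrite hsym_S_S, harm_S, IH. change (hsym 0 (S m)) with 1. unfold Rdiv. ring.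
Qed.

(** * Zeta and zeta-star values as sums of series *)

(** Convergence ensures that [real (Lim_seq _)] is the actual sum and not the default taken at an
    infinite limit. *)
Lemma mzv_eq (s : nat) (ks : list nat) (l : R) :
  is_series (fun i => mzv_trunc ks i / INR (S i) ^ s) l -> mzv (s :: ks) = l.
Proof.
  intros L%is_series_sum_lt. unfold mzv.
  change l with (real (Finite l)). apply f_equal, is_lim_seq_unique.
  apply is_lim_seq_ext with (2 := L). intro N. now rewrite mzv_trunc_cons.
Qed.

Lemma mzsv_eq (s : nat) (ks : list nat) (l : R) :
  is_series (fun i => mzsv_trunc ks (S i) / INR (S i) ^ s) l -> mzsv (s :: ks) = l.
Proof.
  intros L%is_series_sum_lt. unfold mzsv.
  change l with (real (Finite l)). apply f_equal, is_lim_seq_unique.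
  apply is_lim_seq_ext with (2 := L). intro N. now rewrite mzsv_trunc_cons.
Qed.

Lemma is_series_mzv (s r : nat) :
  (2 <= s)%nat ->
  is_series (fun i => esym r i / INR (S i) ^ s) (mzv (s :: repeat 1%nat r)).
Proof.
  intro Hs. destruct (ex_series_harm_dom r s (esym r) Hs) as [l L].
  - intro i. split; [apply esym_ge0|].
    apply Rle_trans with (1 := esym_le_harm_pow r i).
    apply pow_incr. split; [apply harm_ge0|apply harm_mono; lia].
  - now rewrite (mzv_eq s (repeat 1%nat r) l L).
Qed.

Lemma is_series_mzsv (s r : nat) :
  (2 <= s)%nat ->
  is_series (fun i => hsym r (S i) / INR (S i) ^ s) (mzsv (s :: repeat 1%nat r)).
Proof.
  intro Hs. destruct (ex_series_harm_dom r s (fun i => hsym r (S i)) Hs) as [l L].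
  - intro i. split; [apply hsym_ge0|apply hsym_le_harm_pow].
  - now rewrite (mzsv_eq s (repeat 1%nat r) l L).
Qed.

(** * The sums [Q] and the partial-fraction evaluation of zeta-star values *)

(** In the notation above, [Q(k,n)] is [harm_mzv (k+1) (n-1)]. *)
Definition harm_mzv (s r : nat) : R :=
  Series (fun i => esym r i * harm (S i) / INR (S i) ^ s).

Lemma is_series_harm_mzv (s r : nat) :
  (2 <= s)%nat ->
  is_series (fun i => esym r i * harm (S i) / INR (S i) ^ s) (harm_mzv s r).
Proof.
  intro Hs. apply Series_correct.
  apply (ex_series_harm_dom (S r) s (fun i => esym r i * harm (S i)) Hs).
  intro i. assert (P := esym_ge0 r i). assert (Q := harm_ge0 (S i)). split.
  - now apply Rmult_le_pos.
  - rewrite <- tech_pow_Rmult, Rmult_comm. apply Rmult_le_compat_l; [assumption|].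
    apply Rle_trans with (1 := esym_le_harm_pow r i).
    apply pow_incr. split; [apply harm_ge0|apply harm_mono; lia].
Qed.

(* The value of [sum_{b >= 1} 1 / (b^(k+1) (b + i + 1))], reduced by
   [1 / (b^(k+1) (b+a)) = (1 / b^(k+1) - 1 / (b^k (b+a))) / a]. *)
Fixpoint frac_sum (k i : nat) : R :=
  match k with
  | 0%nat => harm (S i) / INR (S i)
  | S k' => (mzv (S k :: nil) - frac_sum k' i) / INR (S i)
  end.

Lemma is_series_frac_sum (k i : nat) :
  is_series (fun j => / INR (S j) ^ S k * / (INR (S j) + INR (S i))) (frac_sum k i).
Proof.
  assert (P := INR_S_pos i).
  induction k as [|k IH].
  - eapply is_series_ext_R; [| |exact (is_series_esym_div_add 0 i)].
    + intro j. cbv beta. rewrite esym_0, pow_1. unfold Rdiv. ring.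
    + now rewrite hsym_1.
  - eapply is_series_ext_R; [| |exact (is_series_mul (/ INR (S i)) _ _ (is_series_add _ _ _ _
      (is_series_mzv (S (S k)) 0 ltac:(lia)) (is_series_mul (-1) _ _ IH)))].
    + intro j. cbv beta. assert (Q := INR_S_pos j).
      assert (Q' := pow_lt _ (S k) Q). rewrite esym_0, <- (tech_pow_Rmult _ (S k)).
      field. lra.
    + cbn [frac_sum repeat]. unfold Rdiv. ring.
Qed.

Lemma sum_lt_recl (N : nat) (f : nat -> R) :
  sum_lt (S N) f = f 0%nat + sum_lt N (fun i => f (S i)).
Proof. unfold sum_lt. simpl. now rewrite <- seq_shift, map_map. Qed.

(** Unrolls [frac_sum]: each level splits off one product of zeta values, flips the sign and divides
    by [a]. That division raises the exponent, so [s] must vary in the induction. The last level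
    [H_a / a] leaves [harm_mzv]. *)
Lemma is_series_esym_frac_sum (r k s : nat) :
  (1 <= s)%nat ->
  is_series (fun i => esym r i / INR (S i) ^ s * frac_sum k i)
    (sum_lt k (fun i => (-1) ^ i * mzv (S k - i :: nil)%nat
                        * mzv (S s + i :: repeat 1%nat r)%nat)
     + (-1) ^ k * harm_mzv (S s + k) r).
Proof.
  revert s; induction k as [|k IH]; intros s Hs.
  - eapply is_series_ext_R; [| |exact (is_series_harm_mzv (S s) r ltac:(lia))].
    + intro i. cbv beta. cbn [frac_sum]. assert (Q := INR_S_pos i).
      assert (Q' := pow_lt _ s Q). rewrite <- tech_pow_Rmult. field. lra.
    + rewrite Nat.add_0_r. unfold sum_lt; simpl. ring.
  - eapply is_series_ext_R; [| |exact (is_series_add _ _ _ _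
      (is_series_mul (mzv (S (S k) :: nil)) _ _ (is_series_mzv (S s) r ltac:(lia)))
      (is_series_mul (-1) _ _ (IH (S s) ltac:(lia))))].
    + intro i. cbv beta. cbn [frac_sum]. assert (Q := INR_S_pos i).
      assert (Q' := pow_lt _ s Q). rewrite <- tech_pow_Rmult. field. lra.
    + rewrite sum_lt_recl, Nat.sub_0_r, Nat.add_0_r.
      rewrite (sum_lt_ext k (fun i => (-1) ^ S i * _ * _)
        (fun i => -1 * ((-1) ^ i * mzv (S k - i :: nil)%nat
                        * mzv (S (S s) + i :: repeat 1%nat r)%nat))).
      * rewrite sum_lt_scal. replace (S s + S k)%nat with (S (S s) + k)%nat by lia.
        simpl pow. ring.
      * intros i _. replace (S s + S i)%nat with (S (S s) + i)%nat by lia.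
        rewrite Nat.sub_succ, <- tech_pow_Rmult. ring.
Qed.

(** Both orders of summation of [e_r(a-1) / (a b^(k+1) (a+b))], with [i] standing for [b] and [j]
    for [a]. Rows give [h_{r+1}(b) / b^(k+2)]; columns are partial fractions. *)
Lemma mzsv_height_one (k r : nat) :
  mzsv (S (S k) :: repeat 1%nat (S r))
  = sum_lt k (fun i => (-1) ^ i * mzv (S k - i :: nil)%nat
                       * mzv (S (S i) :: repeat 1%nat r))
    + (-1) ^ k * harm_mzv (S (S k)) r.
Proof.
  apply double_series_eq with
    (u := fun i j => esym r j / INR (S j) * (/ INR (S i) ^ S k * / (INR (S j) + INR (S i))))
    (r := fun i => hsym (S r) (S i) / INR (S i) ^ S (S k))
    (c := fun j => esym r j / INR (S j) ^ 1 * frac_sum k j).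
  - intros i j. assert (P := INR_S_pos i). assert (Q := INR_S_pos j).
    apply Rmult_le_pos.
    + apply Rdiv_le_0_compat; [apply esym_ge0|assumption].
    + left. apply Rmult_lt_0_compat; apply Rinv_0_lt_compat; [now apply pow_lt|lra].
  - intro i. eapply is_series_ext_R;
      [| |exact (is_series_mul (/ INR (S i) ^ S k) _ _ (is_series_esym_div_add r i))].
    + intro j. cbv beta. ring.
    + assert (P := INR_S_pos i). assert (P' := pow_lt _ (S k) P).
      rewrite <- (tech_pow_Rmult _ (S k)). field. lra.
  - intro j. rewrite pow_1. eapply is_series_ext_R;
      [| reflexivity |exact (is_series_mul (esym r j / INR (S j)) _ _ (is_series_frac_sum k j))].
    intro i. cbv beta. now rewrite (Rplus_comm (INR (S i))).
  - apply is_series_mzsv. lia.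
  - exact (is_series_esym_frac_sum r k 1 (le_n 1)).
Qed.

(** * The inverse binomial weight and the two dualities *)

(** The weight [c(i,j)], which is the reciprocal of the binomial coefficient of [i + j] over [i]. *)
Definition beta (i j : nat) : R := INR (fact i) * INR (fact j) / INR (fact (i + j)).

Lemma beta_sym (i j : nat) : beta i j = beta j i.
Proof. unfold beta. rewrite (Nat.add_comm j i). unfold Rdiv. ring. Qed.

Lemma beta_pos (i j : nat) : 0 < beta i j.
Proof. unfold beta. apply Rdiv_lt_0_compat; [apply Rmult_lt_0_compat|]; apply INR_fact_lt_0. Qed.

Lemma beta_0_r (i : nat) : beta i 0 = 1.
Proof.
  unfold beta. rewrite Nat.add_0_r. simpl (INR (fact 0)). field. apply INR_fact_neq_0.
Qed.

Lemma beta_S_r (i j : nat) : beta i (S j) * INR (S (i + j)) = beta i j * INR (S j).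
Proof.
  unfold beta. rewrite Nat.add_succ_r, !fact_simpl, !mult_INR.
  assert (P := INR_S_pos (i + j)). assert (Q := INR_fact_neq_0 (i + j)). field. lra.
Qed.

(** Differencing in [b] reproduces the weight up to the factor [a / b], so each summation by parts
    lowers the index of [esym] and gains [1 / a]. *)
Lemma beta_diff (i j : nat) :
  beta (S i) j - beta (S i) (S j) = INR (S i) / INR (S j) * beta (S i) (S j).
Proof.
  assert (E := beta_S_r (S i) j). assert (P := INR_S_pos j).
  apply Rmult_eq_reg_r with (INR (S j)); [|lra].
  rewrite Rmult_minus_distr_r, <- E.
  replace (S (S i + j)) with (S i + S j)%nat by lia. rewrite plus_INR. field. lra.
Qed.

(** For [a >= 1] the product [(j + 1) c(a,j)] is nonincreasing in [j] and equals 1 at [j = 0]. This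
    supplies the decay needed at infinity. *)
Lemma beta_le (i j : nat) : beta (S i) j <= / INR (S j).
Proof.
  assert (P := INR_S_pos j).
  apply Rmult_le_reg_r with (INR (S j)); [assumption|]. rewrite Rinv_l by lra.
  clear P. induction j as [|j IH]; [rewrite beta_0_r; simpl; lra|].
  rewrite <- beta_S_r in IH. apply Rle_trans with (2 := IH).
  apply Rmult_le_compat_l; [left; apply beta_pos|apply le_INR; lia].
Qed.

(** The telescoping case [r = 0] gives [c(a,0) / a = 1 / a]; every further summation by parts
    contributes another [1 / a]. *)
Lemma is_series_esym_beta (r i : nat) :
  is_series (fun j => esym r j / INR (S j) * beta (S i) (S j)) (/ INR (S i) ^ S r).
Proof.
  set (g := fun j => beta (S i) j).
  assert (D : forall j, 0 <= g j <= harm (S (0 + j)) ^ 0 / INR (S j)).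
  { intro j. split; [left; apply beta_pos|].
    rewrite pow_O. unfold Rdiv. rewrite Rmult_1_l. apply beta_le. }
  assert (P := INR_S_pos i).
  induction r as [|r IH].
  - eapply is_series_ext_R; [| |exact (is_series_mul (/ INR (S i)) _ _
      (is_series_esym_abel_0 g (esym_mul_decay 0 0 0 g D)))].
    + intro j. cbv beta. unfold g. rewrite beta_diff. assert (Q := INR_S_pos j).
      field. lra.
    + unfold g. rewrite beta_0_r, pow_1. ring.
  - eapply is_series_ext_R; [| |exact (is_series_mul (/ INR (S i)) _ _
      (is_series_esym_abel r g _ (esym_mul_decay _ 0 0 g D) IH))].
    + intro j. cbv beta. unfold g. rewrite beta_diff. assert (Q := INR_S_pos j).
      field. lra.
    + assert (P' := pow_lt _ (S r) P). rewrite <- (tech_pow_Rmult _ (S r)). field. lra.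
Qed.

(** As for the weight alone, but the harmonic factor adds one copy of the previous series at each
    level; these copies accumulate to the coefficient [INR (S r)]. *)
Lemma is_series_esym_beta_harm (r i : nat) :
  is_series (fun j => esym r j / INR (S j) * (beta (S i) (S j) * harm (S i + S j)))
    (harm (S i) / INR (S i) ^ S r + INR (S r) / INR (S i) ^ S (S r)).
Proof.
  set (g := fun j => beta (S i) j * harm (S i + j)).
  assert (D : forall j, 0 <= g j <= harm (S (i + j)) ^ 1 / INR (S j)).
  { intro j. unfold g. split.
    - apply Rmult_le_pos; [left; apply beta_pos|apply harm_ge0].
    - rewrite pow_1. unfold Rdiv. rewrite Rmult_comm. simpl (S i + j)%nat.
      apply Rmult_le_compat_l; [apply harm_ge0|apply beta_le]. }
  assert (P := INR_S_pos i).
  (* With [b = j + 1]: [c(a,b-1) = c(a,b) (a+b) / b], and [H_{a+b-1} = H_{a+b} - 1/(a+b)] produces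
     the correction [- c(a,b) / b]. *)
  assert (E : forall j, g j - g (S j)
    = INR (S i) / INR (S j) * g (S j) - beta (S i) (S j) / INR (S j)).
  { intro j. unfold g. assert (B := beta_diff i j). assert (B' := beta_S_r (S i) j).
    rewrite Nat.add_succ_r, harm_S.
    assert (Q := INR_S_pos j). assert (Q' := INR_S_pos (S i + j)).
    replace (beta (S i) j) with
      (INR (S i) / INR (S j) * beta (S i) (S j) + beta (S i) (S j)) by lra.
    assert (A : INR (S (S i + j)) = INR (S i) + INR (S j))
      by (rewrite <- plus_INR; f_equal; lia).
    rewrite A in *. field. lra. }
  induction r as [|r IH].
  - eapply is_series_ext_R; [| |exact (is_series_mul (/ INR (S i)) _ _ (is_series_add _ _ _ _
      (is_series_esym_abel_0 g (esym_mul_decay 0 1 i g D)) (is_series_esym_beta 0 i)))].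
    + intro j. cbv beta. rewrite E. unfold g. assert (Q := INR_S_pos j).
      field. lra.
    + unfold g. rewrite beta_0_r, Nat.add_0_r. change (INR 1) with 1. cbn [pow]. field. lra.
  - eapply is_series_ext_R; [| |exact (is_series_mul (/ INR (S i)) _ _ (is_series_add _ _ _ _
      (is_series_esym_abel r g _ (esym_mul_decay _ 1 i g D) IH)
      (is_series_esym_beta (S r) i)))].
    + intro j. cbv beta. rewrite E. unfold g. assert (Q := INR_S_pos j).
      field. lra.
    + assert (P' := pow_lt _ (S r) P). rewrite (S_INR (S r)).
      rewrite <- !(tech_pow_Rmult _ (S (S r))), <- (tech_pow_Rmult _ (S r)). field. lra.
Qed.

(** The double series of [e_r(a-1) e_k(b-1) c(a,b) / (a b)] is summed in both orders. Since [c] is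
    symmetric, the columns are the rows with [k] and [r] exchanged. *)
Lemma mzv_height_one_dual (k r : nat) :
  mzv (S (S k) :: repeat 1%nat r) = mzv (S (S r) :: repeat 1%nat k).
Proof.
  assert (L : forall k r i, is_series
    (fun j => esym r i / INR (S i) * (esym k j / INR (S j) * beta (S i) (S j)))
    (esym r i / INR (S i) ^ S (S k))).
  { intros k' r' i. eapply is_series_ext_R; [reflexivity| |
      exact (is_series_mul (esym r' i / INR (S i)) _ _ (is_series_esym_beta k' i))].
    assert (P := INR_S_pos i). assert (P' := pow_lt _ (S k') P).
    rewrite <- (tech_pow_Rmult _ (S k')). field. lra. }
  eapply double_series_eq; [|exact (L k r)| |apply is_series_mzv; lia|apply is_series_mzv; lia].
  - intros i j. apply Rmult_le_pos; [|apply Rmult_le_pos; [|left; apply beta_pos]];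
      apply Rdiv_le_0_compat; auto using esym_ge0, INR_S_pos.
  - intro j. eapply is_series_ext_R; [|reflexivity|exact (L r k j)].
    intro i. cbv beta. rewrite (beta_sym (S j)). ring.
Qed.

(** The same interchange with the additional symmetric weight [H_{a+b}]. *)
Lemma harm_mzv_dual (k r : nat) :
  harm_mzv (S (S k)) r + INR (S k) * mzv (S (S (S k)) :: repeat 1%nat r)
  = harm_mzv (S (S r)) k + INR (S r) * mzv (S (S (S r)) :: repeat 1%nat k).
Proof.
  set (s := fun k r i => esym r i * harm (S i) / INR (S i) ^ S (S k)
                         + INR (S k) * (esym r i / INR (S i) ^ S (S (S k)))).
  assert (L : forall k r i, is_series
    (fun j => esym r i / INR (S i)
              * (esym k j / INR (S j) * (beta (S i) (S j) * harm (S i + S j))))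
    (s k r i)).
  { intros k' r' i. eapply is_series_ext_R; [reflexivity| |
      exact (is_series_mul (esym r' i / INR (S i)) _ _ (is_series_esym_beta_harm k' i))].
    assert (P := INR_S_pos i). assert (P' := pow_lt _ (S k') P). unfold s.
    rewrite <- (tech_pow_Rmult _ (S (S k'))), <- (tech_pow_Rmult _ (S k')).
    field. lra. }
  assert (T : forall k r, is_series (s k r)
    (harm_mzv (S (S k)) r + INR (S k) * mzv (S (S (S k)) :: repeat 1%nat r))).
  { intros k' r'. apply is_series_add; [apply is_series_harm_mzv; lia|].
    apply is_series_mul, is_series_mzv. lia. }
  eapply double_series_eq; [|exact (L k r)| |apply T|apply T].
  - intros i j. apply Rmult_le_pos; [|apply Rmult_le_pos; [|apply Rmult_le_pos;
      [left; apply beta_pos|apply harm_ge0]]];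
      apply Rdiv_le_0_compat; auto using esym_ge0, INR_S_pos.
  - intro j. eapply is_series_ext_R; [|reflexivity|exact (L r k j)].
    intro i. cbv beta. rewrite (beta_sym (S j)), (Nat.add_comm (S j)). ring.
Qed.

(** * Combination of the evaluation with the two dualities *)

Theorem theorem2p1 (k n : nat) (hk : (1 <= k)%nat) (hn : (1 <= n)%nat) :
  (-1) ^ k * mzsv ((k + 1)%nat :: repeat 1%nat n)
  - (-1) ^ n * mzsv ((n + 1)%nat :: repeat 1%nat k)
  = INR k * mzv ((k + 2)%nat :: repeat 1%nat (n - 1))
    - INR n * mzv ((n + 2)%nat :: repeat 1%nat (k - 1))
    + (-1) ^ k * sum_lt (k - 1)
        (fun r => (-1) ^ r * mzv ((k - r)%nat :: nil)
                  * mzv ((n + 1)%nat :: repeat 1%nat r))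
    - (-1) ^ n * sum_lt (n - 1)
        (fun r => (-1) ^ r * mzv ((n - r)%nat :: nil)
                  * mzv ((k + 1)%nat :: repeat 1%nat r)).
Proof.
  destruct k as [|k]; [lia|]. destruct n as [|n]; [lia|]. clear hk hn.
  (* Duality turns [zeta(i+2,1^n)] from the evaluation into [zeta(n+2,1^i)], the shape of the
     products in the claim. *)
  assert (H : forall k n, (-1) ^ S k * mzsv (S (S k) :: repeat 1%nat (S n))
    = (-1) ^ S k * sum_lt k (fun r => (-1) ^ r * mzv ((S k - r)%nat :: nil)
                                      * mzv (S (S n) :: repeat 1%nat r))
      - harm_mzv (S (S k)) n).
  { intros k' n'. rewrite mzsv_height_one.
    rewrite (sum_lt_ext k' _ (fun r => (-1) ^ r * mzv ((S k' - r)%nat :: nil)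
                                      * mzv (S (S n') :: repeat 1%nat r)))
      by (intros i _; now rewrite (mzv_height_one_dual i n')).
    (* The prefactor cancels the sign of [harm_mzv] up to a single minus, whatever the parity of
       [k']. *)
    assert (E : (-1) ^ k' * (-1) ^ k' = 1)
      by (rewrite <- Rpow_mult_distr; replace (-1 * -1) with 1 by ring; apply pow1).
    simpl pow. rewrite Rmult_plus_distr_l.
    replace (-1 * (-1) ^ k' * ((-1) ^ k' * harm_mzv (S (S k')) n'))
      with (- ((-1) ^ k' * (-1) ^ k') * harm_mzv (S (S k')) n') by ring.
    rewrite E. ring. }
  rewrite !(Nat.add_comm _ 1), !(Nat.add_comm _ 2). cbn [Nat.add].
  rewrite !(Nat.sub_succ _ 0), !Nat.sub_0_r, !H.
  (* Subtracting the two instances of [H] leaves a difference of two [harm_mzv] values, which [D]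
     converts into the two linear zeta terms. *)
  assert (D := harm_mzv_dual k n). lra.
Qed.
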